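(* Suppose that $f_2(x)>0$ for every $x\in\mathbb{R}^n$ with $g(x)\le 0$, and that there exists $\bar{x}\in\mathbb{R}^n$ with $g(\bar{x})<0$. Then the optimal value $$\lambda^*=\inf_{x\in\mathbb{R}^n}\left\{\frac{f_1(x)}{f_2(x)}: g(x)\le 0\right\}$$ is given by the semidefinite program $$\lambda^*=\sup_{\lambda\in\mathbb{R},\,\mu\ge 0}\left\{\lambda:\begin{pmatrix}A_1-\lambda A_2+\mu B & b_1-\lambda b_2+\mu d\\ b_1^T-\lambda b_2^T+\mu d^T & c_1-\lambda c_2+\mu\alpha\end{pmatrix}\succeq 0\right\}.$$
   Context: For $i=1,2$ let $f_i(x)=x^TA_ix+2b_i^Tx+c_i$ and let $g(x)=x^TBx+2d^Tx+\alpha$ be functions on $\mathbb{R}^n$, where $A_1,A_2,B$ are real symmetric $n\times n$ matrices (possibly indefinite), $b_1,b_2,d\in\mathbb{R}^n$ and $c_1,c_2,\alpha\in\mathbb{R}$. The notation $M\succeq 0$ means that the symmetric matrix $M$ is positive semidefinite. Optimal values are taken in the extended reals, with $\sup\emptyset=-\infty$. *)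

(* Defs.v *)
From HB Require Import structures.
From mathcomp Require Import all_boot all_order all_algebra.
From mathcomp Require Import all_classical all_reals ereal.

Set Implicit Arguments.
Unset Strict Implicit.
Unset Printing Implicit Defensive.

Import Order.TTheory GRing.Theory Num.Theory.

Local Open Scope classical_set_scope.
Local Open Scope ring_scope.

(* x |-> x^T A x + 2 b^T x + c; the products are 1 x 1 matrices, read off at
   their only entry. *)
Definition quadfun (R : realType) (n : nat)
    (A : 'M[R]_n) (b : 'cV[R]_n) (c : R) (x : 'cV[R]_n) : R :=
  (x^T *m A *m x) 0 0 + 2 * (b^T *m x) 0 0 + c.

(* As for the usual order on symmetric matrices, symmetry is part of the
   definition. *)
Definition psdmx (R : realType) (m : nat) (M : 'M[R]_m) : Prop :=
  M \is symmetricmx /\ forall x : 'cV[R]_m, 0 <= (x^T *m M *m x) 0 0.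

Definition ratio_inf (R : realType) (n : nat) (f1 f2 g : 'cV[R]_n -> R) : \bar R :=
  ereal_inf [set (f1 x / f2 x)%:E | x in [set x | g x <= 0]].

Definition lmi (R : realType) (n : nat)
    (A1 A2 B : 'M[R]_n) (b1 b2 d : 'cV[R]_n) (c1 c2 alpha : R) (l mu : R) :
    'M[R]_(n + 1) :=
  block_mx
    (A1 - l *: A2 + mu *: B)          (b1 - l *: b2 + mu *: d)
    (b1^T - l *: b2^T + mu *: d^T)    (c1 - l * c2 + mu * alpha)%:M.

Definition sdp_sup (R : realType) (n : nat)
    (A1 A2 B : 'M[R]_n) (b1 b2 d : 'cV[R]_n) (c1 c2 alpha : R) : \bar R :=
  ereal_sup [set p.1%:E | p in [set p : R * R |
    0 <= p.2 /\ psdmx (lmi A1 A2 B b1 b2 d c1 c2 alpha p.1 p.2)]].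

(* Main.v *)
(** For every real [l], [l] is a lower bound of the ratio iff
    [f1 - l f2 >= 0] on [g <= 0], and by the S-lemma (valid under the Slater
    condition) iff [f1 - l f2 + mu g >= 0] everywhere for some [mu >= 0], which
    is positive semidefiniteness of the homogenized matrix.

    In the S-lemma, a multiplier exists as soon as
    [f x / g x >= f y / g y] whenever [g x > 0 > g y], and this only involves
    the line through [x] and [y].  There, after homogenization, [g] becomes a
    binary form with one negative and one positive root, at both of which [f]
    is nonnegative; a positive combination of these two values of [f] gives the
    inequality. *)
Require Import Defs.
From mathcomp Require Import all_boot all_order all_algebra.
From mathcomp Require Import all_classical all_reals ereal.
From mathcomp Require Import ring lra.

Import Order.TTheory GRing.Theory Num.Theory.

Local Open Scope ring_scope.

Lemma quadratic_nonneg_lead (R : realFieldType) (a b c : R) :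
  (forall t, 0 <= t -> 0 <= c + t * b + t ^+ 2 * a) -> 0 <= a.
Proof.
move=> h; rewrite leNgt; apply/negP => a_lt0.
(* This [t >= 1] satisfies [t * a = a - |b| - |c|], so the whole quadratic is at most [t * a < 0]
   there. *)
pose t := 1 + (`|b| + `|c|) / - a.
have k0 : 0 <= (`|b| + `|c|) / - a.
  by rewrite divr_ge0 ?addr_ge0 // oppr_ge0 ltW.
have t1 : 1 <= t by rewrite lerDl.
have ta : t * a = a - `|b| - `|c|.
  by rewrite /t; field; rewrite lt_eqF.
have := h t (le_trans ler01 t1).
have hb : t * b <= t * `|b| by rewrite ler_wpM2l ?ler_norm // (le_trans ler01).
have hc : c <= t * `|c|.
  by rewrite (le_trans (ler_norm c)) // ler_peMl.
have -> : t ^+ 2 * a = t * a - t * `|b| - t * `|c|.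
  by rewrite -!mulrBr -ta expr2 mulrA.
have : t * a < 0 by rewrite pmulr_rlt0 // (lt_le_trans ltr01).
lra.
Qed.

(** Since [a * c < 0], the root [s] of the discriminant exceeds [|b|], so [- b - s] and [- b + s]
    have opposite signs. *)
Lemma quadratic_roots_opp_sign (R : rcfType) (a b c : R) :
  0 < a -> c < 0 ->
  exists r1 r2, [/\ r1 < 0, 0 < r2,
    forall t, c + t * b + t ^+ 2 * a = a * (t - r1) * (t - r2) &
    a * (r1 * r2) = c].
Proof.
move=> a0 c0; pose s := Num.sqrt (b ^+ 2 - 4 * a * c).
have ac : a * c < 0 by rewrite pmulr_rlt0.
have D0 : 0 <= b ^+ 2 - 4 * a * c by have := sqr_ge0 b; nra.
have s2 : s ^+ 2 = b ^+ 2 - 4 * a * c by rewrite sqr_sqrtr.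
have bs : `|b| < s.
  by rewrite -sqrtr_sqr ltr_sqrt; have := sqr_ge0 b; nra.
have /andP[bs1 bs2] : - s < b < s by rewrite -ltr_norml.
have a2 : 0 < (2 * a)^-1 by rewrite invr_gt0 mulr_gt0.
have cE : c = (b ^+ 2 - s ^+ 2) / (4 * a).
  by rewrite s2; field; rewrite gt_eqF.
exists ((- b - s) / (2 * a)), ((- b + s) / (2 * a)); split.
- by rewrite pmulr_llt0 //; lra.
- by rewrite pmulr_lgt0 //; lra.
- by move=> t; rewrite cE; field; rewrite gt_eqF.
- by rewrite cE; field; rewrite gt_eqF.
Qed.

Lemma two_point_ineq_line (R : rcfType) (p0 p1 p2 q0 q1 q2 : R) :
  (forall t, q0 + t * q1 + t ^+ 2 * q2 <= 0 ->
             0 <= p0 + t * p1 + t ^+ 2 * p2) ->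
  0 < q0 -> q0 + q1 + q2 < 0 ->
  0 <= (p0 + p1 + p2) * q0 - p0 * (q0 + q1 + q2).
Proof.
move=> h q0_gt0 q_lt0.
have [r1 [r2 [r1_lt0 r2_gt0 rE rM]]] :=
  quadratic_roots_opp_sign _ _ (q0 *+ 2 + q1) _ q0_gt0 q_lt0.
(* The form at [(1 + t, 1)] is [(1 + t) ^+ 2] times its value at the point
   [1 / (1 + t)] of the line; [t = -1] is the point at infinity. *)
have root_ge0 t : (q0 + q1 + q2) + t * (q0 *+ 2 + q1) + t ^+ 2 * q0 = 0 ->
    0 <= (p0 + p1 + p2) + t * (p0 *+ 2 + p1) + t ^+ 2 * p0.
  have [-> qE|tN1 qE] := eqVneq t (- 1).
    (* Here [q] is affine and decreasing, so it stays negative at all parameters [1 + s] with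
       [s >= 0]; [p] is nonnegative on this ray, hence so is its leading coefficient. *)
    have q2E : q2 = 0 by rewrite -qE; ring.
    have -> : p0 + p1 + p2 + -1 * (p0 *+ 2 + p1) + (-1) ^+ 2 * p0 = p2 by ring.
    apply: (@quadratic_nonneg_lead _ _ (p1 + p2 *+ 2) (p0 + p1 + p2)) => s s0.
    have -> : p0 + p1 + p2 + s * (p1 + p2 *+ 2) + s ^+ 2 * p2 =
              p0 + (1 + s) * p1 + (1 + s) ^+ 2 * p2 by ring.
    by apply: h; rewrite q2E; nra.
  have t1 : 1 + t != 0 by rewrite addrC addr_eq0.
  have -> : p0 + p1 + p2 + t * (p0 *+ 2 + p1) + t ^+ 2 * p0 =
      (1 + t) ^+ 2 * (p0 + (1 + t)^-1 * p1 + (1 + t)^-1 ^+ 2 * p2) by field.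
  rewrite mulr_ge0 ?sqr_ge0 //; apply: h.
  have -> : q0 + (1 + t)^-1 * q1 + (1 + t)^-1 ^+ 2 * q2 =
      (1 + t) ^- 2 * (q0 + q1 + q2 + t * (q0 *+ 2 + q1) + t ^+ 2 * q0) by field.
  by rewrite qE mulr0.
have h1 : 0 <= p0 + p1 + p2 + r1 * (p0 *+ 2 + p1) + r1 ^+ 2 * p0.
  by apply: root_ge0; rewrite rE subrr mulr0 mul0r.
have h2 : 0 <= p0 + p1 + p2 + r2 * (p0 *+ 2 + p1) + r2 ^+ 2 * p0.
  by apply: root_ge0; rewrite rE subrr mulr0.
rewrite -rM.
(* The positive weights [r2] and [- r1] cancel the term linear in the root. *)
have -> : (p0 + p1 + p2) * q0 - p0 * (q0 * (r1 * r2)) =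
    q0 / (r2 - r1) *
    (r2 * (p0 + p1 + p2 + r1 * (p0 *+ 2 + p1) + r1 ^+ 2 * p0) +
     - r1 * (p0 + p1 + p2 + r2 * (p0 *+ 2 + p1) + r2 ^+ 2 * p0)).
  by field; rewrite subr_eq0 gt_eqF // (lt_trans r1_lt0).
rewrite mulr_ge0 ?divr_ge0 ?addr_ge0 ?mulr_ge0 //; lra.
Qed.

Lemma quadfun_line (R : realType) (n : nat) (A : 'M[R]_n) (b : 'cV[R]_n) (c : R)
    (x w : 'cV[R]_n) (t : R) :
  quadfun A b c (x + t *: w) =
  quadfun A b c x +
  t * ((x^T *m A *m w) 0 0 + (w^T *m A *m x) 0 0 + 2 * (b^T *m w) 0 0) +
  t ^+ 2 * (w^T *m A *m w) 0 0.
Proof.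
rewrite /quadfun [(_ + _)^T]linearD /= [(_ *: _)^T]linearZ /=.
rewrite !(mulmxDl, mulmxDr) -!(scalemxAl, scalemxAr).
by rewrite !mxE; ring.
Qed.

Lemma quadfun_two_point_ineq (R : realType) (n : nat) (A B : 'M[R]_n)
    (b d : 'cV[R]_n) (c e : R) :
  (forall x, quadfun B d e x <= 0 -> 0 <= quadfun A b c x) ->
  forall x y, 0 < quadfun B d e x -> quadfun B d e y < 0 ->
  0 <= quadfun A b c y * quadfun B d e x - quadfun A b c x * quadfun B d e y.
Proof.
move=> h x y gx gy.
have yE : y = x + 1 *: (y - x) by rewrite scale1r addrC subrK.
move: gy; rewrite yE !quadfun_line !mul1r expr1n !mul1r => gy.
by apply: two_point_ineq_line => // t; rewrite -!quadfun_line; exact: h.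
Qed.

Lemma S_lemma (R : realType) (n : nat) (A B : 'M[R]_n) (b d : 'cV[R]_n)
    (c e : R) :
  (exists x, quadfun B d e x < 0) ->
  (forall x, quadfun B d e x <= 0 -> 0 <= quadfun A b c x) ->
  exists2 mu, 0 <= mu & forall x, 0 <= quadfun A b c x + mu * quadfun B d e x.
Proof.
move=> [x0 gx0] h.
pose f := quadfun A b c; pose g := quadfun B d e.
(* [S] collects the lower bounds that [mu] must respect; [0] encodes [mu >= 0] and keeps [S]
   nonempty. Points with [g < 0] give the upper bounds, and the Slater point shows that there is
   one. *)
pose S : set R := [set r | r = 0 \/ exists2 x, 0 < g x & r = - f x / g x]%classic.
have S0 : S 0 by left.
have S_ub y : g y < 0 -> ubound S (- f y / g y).
  move=> gy _ [->|[x gx ->]].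
    by rewrite -mulrNN opprK -invrN divr_ge0 ?oppr_ge0 ?(ltW gy) ?h // ltW.
  have := quadfun_two_point_ineq _ _ _ _ _ _ _ _ h x y gx gy.
  rewrite -/f -/g -[_ <= - f y / _]subr_ge0 => fg.
  have -> : - f y / g y - - f x / g x =
            (f y * g x - f x * g y) * (g x * - g y)^-1.
    by field; rewrite ?oppr_eq0 (gt_eqF gx) (lt_eqF gy).
  by rewrite divr_ge0 // ltW // mulr_gt0 ?oppr_gt0.
have S_sup : has_sup S by split; [exists 0 | exists (- f x0 / g x0); exact: S_ub].
exists (sup S); first exact: ub_le_sup (S_sup.2) _ S0.
move=> x; rewrite -/f -/g; have [gx|gx|gx] := ltgtP (g x) 0.
- have : sup S <= - f x / g x by apply: ge_sup; [exists 0 | exact: S_ub].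
  by rewrite ler_ndivlMr //; lra.
- have : - f x / g x <= sup S by apply: ub_le_sup (S_sup.2) _ _; right; exists x.
  by rewrite ler_pdivrMr //; lra.
- by rewrite gx mulr0 addr0 h // -/(g x) gx.
Qed.

Lemma symmetricmxE (R : fieldType) (n : nat) (A : 'M[R]_n) :
  (A \is symmetricmx) = (A^T == A).
Proof. by rewrite qualifE /= scale1r map_mx_id // eq_sym. Qed.

(** At [(x, s)] with [s != 0] the form is [s ^+ 2] times the quadratic function at [s^-1 *: x]. At
    [s = 0] it is the leading coefficient of that function along the ray through [x]. *)
Lemma psdmx_homogenized (R : realType) (n : nat) (A : 'M[R]_n) (b : 'cV[R]_n)
    (c : R) : A \is symmetricmx ->
  psdmx (block_mx A b b^T c%:M : 'M[R]_(n + 1)) <->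
  forall x, 0 <= quadfun A b c x.
Proof.
move=> symA.
have formE (x : 'cV[R]_n) (s : R) :
    ((col_mx x s%:M)^T *m (block_mx A b b^T c%:M : 'M[R]_(n + 1)) *m
      col_mx x s%:M) 0 0 =
    (x^T *m A *m x) 0 0 + 2 * s * (b^T *m x) 0 0 + s ^+ 2 * c.
  rewrite tr_col_mx mul_row_block mul_row_col tr_scalar_mx !mul_mx_scalar.
  rewrite !mul_scalar_mx !mulmxDl -!scalemxAl.
  have -> : x^T *m b = b^T *m x.
    by rewrite -[LHS]trmxK trmx_mul trmxK [LHS]mx11_scalar [RHS]mx11_scalar mxE.
  by rewrite !mxE eqxx !mulr1n; ring.
split=> [[_ M0] x|f_ge0].
  by have := M0 (col_mx x 1%:M); rewrite formE mulr1 expr1n mul1r.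
split=> [|z].
  move: symA; rewrite !symmetricmxE => /eqP sA.
  by rewrite tr_block_mx trmxK tr_scalar_mx sA.
rewrite -(vsubmxK z) (mx11_scalar (dsubmx z)) formE.
move: (usubmx z) (dsubmx z 0 0) => x s.
have [->|s0] := eqVneq s 0.
  rewrite mulr0 expr0n !mul0r !addr0.
  apply: (@quadratic_nonneg_lead _ _ (2 * (b^T *m x) 0 0) c) => t _.
  have := f_ge0 (0 + t *: x); rewrite quadfun_line /quadfun.
  by rewrite trmx0 !mul0mx !mulmx0 !mxE !mulr0 !add0r.
have := f_ge0 (0 + s^-1 *: x); rewrite quadfun_line /quadfun.
rewrite trmx0 !mul0mx !mulmx0 [X in X + _ + c]mxE [(0 : 'M_1) 0 0]mxE.
rewrite !mulr0 !add0r => fs.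
have -> : (x^T *m A *m x) 0 0 + 2 * s * (b^T *m x) 0 0 + s ^+ 2 * c =
  s ^+ 2 * (c + s^-1 * (2 * (b^T *m x) 0 0) + s^-1 ^+ 2 * (x^T *m A *m x) 0 0).
  by field.
by rewrite mulr_ge0 ?sqr_ge0.
Qed.

Lemma quadfunDZ (R : realType) (n : nat) (A B : 'M[R]_n) (b d : 'cV[R]_n)
    (c e k : R) (x : 'cV[R]_n) :
  quadfun (A + k *: B) (b + k *: d) (c + k * e) x =
  quadfun A b c x + k * quadfun B d e x.
Proof.
rewrite /quadfun [(_ + _)^T]linearD /= [(_ *: _)^T]linearZ /=.
rewrite !(mulmxDl, mulmxDr) -!(scalemxAl, scalemxAr).
by rewrite !mxE; ring.
Qed.

Lemma symmetricmxDZ (R : realType) (n : nat) (A B : 'M[R]_n) (k : R) :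
  A \is symmetricmx -> B \is symmetricmx -> A + k *: B \is symmetricmx.
Proof.
by rewrite !symmetricmxE => /eqP sA /eqP sB; rewrite linearD linearZ /= sA sB.
Qed.

Lemma psdmx_lmi (R : realType) (n : nat) (A1 A2 B : 'M[R]_n)
    (b1 b2 d : 'cV[R]_n) (c1 c2 alpha l mu : R) :
  A1 \is symmetricmx -> A2 \is symmetricmx -> B \is symmetricmx ->
  psdmx (lmi A1 A2 B b1 b2 d c1 c2 alpha l mu) <->
  forall x, 0 <= quadfun A1 b1 c1 x - l * quadfun A2 b2 c2 x +
                 mu * quadfun B d alpha x.
Proof.
(* With differences turned into sums, the matrix is the homogenization of a single quadratic
   function. *)
move=> symA1 symA2 symB; rewrite /lmi -!scaleNr -mulNr.
have -> : b1^T + - l *: b2^T + mu *: d^T = (b1 + - l *: b2 + mu *: d)^T.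
  by rewrite !linearD !linearZ.
rewrite psdmx_homogenized; last by rewrite !symmetricmxDZ.
by split=> h x; have := h x; rewrite !quadfunDZ mulNr.
Qed.

Theorem theorem3p2 (R : realType) (n : nat)
    (A1 A2 B : 'M[R]_n) (b1 b2 d : 'cV[R]_n) (c1 c2 alpha : R)
    (symA1 : A1 \is symmetricmx) (symA2 : A2 \is symmetricmx)
    (symB : B \is symmetricmx)
    (f2_gt0 : forall x : 'cV[R]_n,
       quadfun B d alpha x <= 0 -> 0 < quadfun A2 b2 c2 x)
    (slater : exists xbar : 'cV[R]_n, quadfun B d alpha xbar < 0) :
  ratio_inf (quadfun A1 b1 c1) (quadfun A2 b2 c2) (quadfun B d alpha) =
  sdp_sup A1 A2 B b1 b2 d c1 c2 alpha.
Proof.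
apply/eqP; rewrite eq_le; apply/andP; split; last first.
  (* Weak duality: [mu * g x <= 0] at a feasible [x], so [f1 x - l * f2 x >= 0]. *)
  apply: ge_ereal_sup => _ [[l mu] /= [mu0 psd] <-].
  apply: le_ereal_inf_tmp => _ [x gx <-].
  have := (psdmx_lmi _ _ _ _ _ _ _ _ _ _ _ _ _ symA1 symA2 symB).1 psd x.
  rewrite lee_fin ler_pdivlMr ?f2_gt0 //.
  by have := mulr_ge0_le0 mu0 gx; lra.
have sdp_ge (l : R) : (l%:E <=
    ratio_inf (quadfun A1 b1 c1) (quadfun A2 b2 c2) (quadfun B d alpha))%E ->
    (l%:E <= sdp_sup A1 A2 B b1 b2 d c1 c2 alpha)%E.
  move=> l_le.
  have [x gx|mu mu0 fg] := @S_lemma _ _ (A1 + - l *: A2) B (b1 + - l *: b2) d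
    (c1 + - l * c2) alpha slater.
    have : (l%:E <= (quadfun A1 b1 c1 x / quadfun A2 b2 c2 x)%:E)%E.
      by apply: (le_trans l_le); apply: ereal_inf_lbound; exists x.
    by rewrite lee_fin ler_pdivlMr ?f2_gt0 // quadfunDZ mulNr subr_ge0.
  apply: ereal_sup_ubound; exists (l, mu) => //; split=> //=.
  apply/psdmx_lmi => // x; rewrite -mulNr -quadfunDZ; exact: fg.
(* The Slater point is feasible, so the infimum is not [+oo]; a real infimum is itself an admissible
   [l], and [-oo] is trivial. *)
have [x gx] := slater.
have : (ratio_inf (quadfun A1 b1 c1) (quadfun A2 b2 c2) (quadfun B d alpha) <=
    (quadfun A1 b1 c1 x / quadfun A2 b2 c2 x)%:E)%E.
  by apply: ereal_inf_lbound; exists x => //=; exact: ltW.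
move: sdp_ge; case: ratio_inf => [r|//|//] sdp_ge _; first exact: sdp_ge.
exact: leNye.
Qed.
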